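(* Let $k\ge2$ and let $M_+\subset\mathbb{O}^k\oplus\mathbb{O}^k=\mathbb{R}^{16k}$ be the focal submanifold of OT-FKM type with $(g,m_1,m_2)=(4,8,8k-9)$ in the definite case, with respect to the symmetric Clifford system $$P_0(u,v)=(u,-v),\quad P_1(u,v)=(v,u),\quad P_{1+\alpha}(u,v)=(E_\alpha v,-E_\alpha u),\quad \alpha=1,\dots,7,$$ where $E_\alpha u=(e_\alpha u_1,\dots,e_\alpha u_k)$. Then $(z,w)\in M_+$ if and only if $$|z|=|w|=\frac1{\sqrt2},\qquad \langle z,w\rangle_{\mathbb{O}}=0.$$
   Context: $\mathbb{O}=\mathbb{H}\oplus\mathbb{H}$ is the algebra of octonions with product $(a,b)(c,d)=(ac-\bar d b,\,da+b\bar c)$ and standard orthonormal basis $1=(1,0)$, $e_1=(\mathrm{i},0)$, $e_2=(\mathrm{j},0)$, $e_3=(\mathrm{k},0)$, $e_4=(0,1)$, $e_5=(0,\mathrm{i})$, $e_6=(0,\mathrm{j})$, $e_7=(0,\mathrm{k})$. For $z,w\in\mathbb{O}^k$, $\langle z,w\rangle_{\mathbb{O}}=\sum_{i=1}^kz_i\overline{w}_i$, and the Euclidean inner product is $\langle z,w\rangle=\mathrm{Re}\langle z,w\rangle_{\mathbb{O}}$. Symmetric Clifford system: symmetric endomorphisms $P_0,\dots,P_m$ of $\mathbb{R}^{2l}$ with $P_iP_j+P_jP_i=2\delta_{ij}I_{2l}$; its OT-FKM type isoparametric family has $g=4$ distinct principal curvatures with multiplicities $(m_1,m_2)=(m,l-m-1)$,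 $l-m-1>0$, and focal submanifold $M_+=\{x\in S^{2l-1}:\langle P_ix,x\rangle=0,\ 0\le i\le m\}$. Here $m=8$, $l=8k$. It is called definite if $P_0P_1\cdots P_m=\pm I_{2l}$; the displayed system satisfies $P_0\cdots P_8=-I_{16k}$. *)

(* Defs.v *)
From HB Require Import structures.
From mathcomp Require Import all_boot all_order all_algebra.
From mathcomp Require Import ring lra zify.
From mathcomp Require Import classical_sets reals.

Set Implicit Arguments.
Unset Strict Implicit.
Unset Printing Implicit Defensive.

Import Order.TTheory GRing.Theory Num.Theory.

Local Open Scope ring_scope.
Local Open Scope classical_set_scope.

(* A Euclidean space is a finite-dimensional real vector space V together with
   a positive definite symmetric bilinear form dot : {dot V for idfun}. *)

Definition enorm (R : realType) (V : vectType R) (dot : {dot V for idfun})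
  (x : V) : R := Num.sqrt (dot x x).

Definition unit_sphere (R : realType) (V : vectType R)
  (dot : {dot V for idfun}) : set V := [set x | enorm dot x = 1].

Record clifford_system (R : realType) (V : vectType R)
    (dot : {dot V for idfun}) (m l : nat) := CliffordSystem {
  clifford_op :> 'I_m.+1 -> 'End(V);
  clifford_dim : \dim {: V} = (2 * l)%N;
  clifford_sym : forall i x y,
    dot (clifford_op i x) y = dot x (clifford_op i y);
  clifford_rel : forall i j,
    (clifford_op i \o clifford_op j)%VF + (clifford_op j \o clifford_op i)%VF
      = (2 * (i == j)%:R) *: \1%VF }.

Definition clifford_prod (R : realType) (V : vectType R)
    (dot : {dot V for idfun}) (m l : nat) (P : clifford_system dot m l) :
  'End(V) := \big[@comp_lfun _ V V V / \1%VF]_(i < m.+1) P i.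

Definition clifford_definite (R : realType) (V : vectType R)
    (dot : {dot V for idfun}) (m l : nat) (P : clifford_system dot m l) :=
  clifford_prod P = \1%VF \/ clifford_prod P = - \1%VF.

(* The OT-FKM multiplicities of a Clifford system P_0, ..., P_m on R^(2l) are
   m1 = m and m2 = l - m - 1 > 0; here l is recovered as m1 + m2 + 1. *)
Record otfkm (R : realType) (V : vectType R) (dot : {dot V for idfun})
    (m1 m2 : nat) := OTFKM {
  otfkm_system :> clifford_system dot m1 (m1 + m2).+1;
  otfkm_m2_gt0 : (0 < m2)%N }.

(* The focal submanifold M_+. *)
Definition focal_plus (R : realType) (V : vectType R)
    (dot : {dot V for idfun}) (m1 m2 : nat) (P : otfkm dot m1 m2) : set V :=
  unit_sphere dot `&` [set x | forall i : 'I_m1.+1, dot (P i x) x = 0].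

(* (a, b, c, d) is a + b i + c j + d k. The multiplication is hmul; the ring
   product that R^o * R^o * R^o * R^o carries by unfolding is componentwise
   and is never used. *)
Definition quaternion (R : realType) := (R^o * R^o * R^o * R^o)%type.

HB.instance Definition _ (R : realType) := Vector.on (quaternion R).

Definition hmul (R : realType) (p q : quaternion R) : quaternion R :=
  let: (a, b, c, d) := p in let: (a', b', c', d') := q in
  (a * a' - b * b' - c * c' - d * d',
   a * b' + b * a' + c * d' - d * c',
   a * c' - b * d' + c * a' + d * b',
   a * d' + b * c' - c * b' + d * a').

Definition hconj (R : realType) (p : quaternion R) : quaternion R :=
  let: (a, b, c, d) := p in (a, - b, - c, - d).

Definition hre (R : realType) (p : quaternion R) : R := p.1.1.1.

Definition h1 (R : realType) : quaternion R := (1, 0, 0, 0).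
Definition hi (R : realType) : quaternion R := (0, 1, 0, 0).
Definition hj (R : realType) : quaternion R := (0, 0, 1, 0).
Definition hk (R : realType) : quaternion R := (0, 0, 0, 1).

Definition octonion (R : realType) := (quaternion R * quaternion R)%type.

HB.instance Definition _ (R : realType) := Vector.on (octonion R).

Definition omul (R : realType) (x y : octonion R) : octonion R :=
  let: (a, b) := x in let: (c, d) := y in
  (hmul a c - hmul (hconj d) b, hmul d a + hmul b (hconj c)).

Definition oconj (R : realType) (x : octonion R) : octonion R :=
  (hconj x.1, - x.2).

Definition ore (R : realType) (x : octonion R) : R := hre x.1.

(* oct_e R 0 is the unit of the octonions. *)
Definition oct_e (R : realType) (a : nat) : octonion R :=
  nth 0 [:: (h1 R, 0); (hi R, 0); (hj R, 0); (hk R, 0);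
            (0, h1 R); (0, hi R); (0, hj R); (0, hk R)] a.

Definition octvec (R : realType) (k : nat) := {ffun 'I_k -> octonion R}.

HB.instance Definition _ (R : realType) (k : nat) := Vector.on (octvec R k).

Definition oct_herm (R : realType) (k : nat) (z w : octvec R k) : octonion R :=
  \sum_(i < k) omul (z i) (oconj (w i)).

Definition oct_dot (R : realType) (k : nat) (z w : octvec R k) : R :=
  ore (oct_herm z w).

Definition octpair (R : realType) (k : nat) := (octvec R k * octvec R k)%type.

HB.instance Definition _ (R : realType) (k : nat) := Vector.on (octpair R k).

Definition octpair_dot (R : realType) (k : nat) (x y : octpair R k) : R :=
  oct_dot x.1 y.1 + oct_dot x.2 y.2.

Definition oct_E (R : realType) (k : nat) (a : nat) (u : octvec R k) :
  octvec R k := [ffun i => omul (oct_e R a) (u i)].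

Definition oct_P0 (R : realType) (k : nat) (x : octpair R k) : octpair R k :=
  (x.1, - x.2).

Definition oct_P1 (R : realType) (k : nat) (x : octpair R k) : octpair R k :=
  (x.2, x.1).

Definition oct_PE (R : realType) (k : nat) (a : nat) (x : octpair R k) :
  octpair R k := (oct_E a x.2, - oct_E a x.1).

(* In the last case i = 1 + a with 1 <= a <= 7. *)
Definition oct_P (R : realType) (k : nat) (i : 'I_9) :
  'End(octpair R k) :=
  match val i with
  | 0 => linfun (@oct_P0 R k)
  | 1 => linfun (@oct_P1 R k)
  | S (S _ as a) => linfun (@oct_PE R k a)
  end.

Lemma hE (R : realType) (a b c d a' b' c' d' : R) :
  a = a' -> b = b' -> c = c' -> d = d' ->
  (a, b, c, d) = (a', b', c', d') :> quaternion R.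
Proof. by move=> -> -> -> ->. Qed.

Lemma oE (R : realType) (p q p' q' : quaternion R) :
  p = p' -> q = q' -> (p, q) = (p', q') :> octonion R.
Proof. by move=> -> ->. Qed.

Lemma addh (R : realType) (a b c d a' b' c' d' : R) :
  ((a, b, c, d) : quaternion R) + ((a', b', c', d') : quaternion R)
    = (a + a', b + b', c + c', d + d').
Proof. by []. Qed.

Lemma opph (R : realType) (a b c d : R) :
  - ((a, b, c, d) : quaternion R) = (- a, - b, - c, - d).
Proof. by []. Qed.

Lemma scaleh (R : realType) (x a b c d : R) :
  x *: ((a, b, c, d) : quaternion R) = (x * a, x * b, x * c, x * d).
Proof. by []. Qed.

Lemma addo (R : realType) (a b c d : quaternion R) :
  ((a, b) : octonion R) + ((c, d) : octonion R) = (a + c, b + d).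
Proof. by []. Qed.

Lemma oppo (R : realType) (a b : quaternion R) :
  - ((a, b) : octonion R) = (- a, - b).
Proof. by []. Qed.

Lemma scaleo (R : realType) (x : R) (a b : quaternion R) :
  x *: ((a, b) : octonion R) = (x *: a, x *: b).
Proof. by []. Qed.

Definition oct_simp := (addo, oppo, scaleo, addh, opph, scaleh).

Lemma omul_linearr (R : realType) (x : octonion R) (a : R) (y z : octonion R) :
  omul x (a *: y + z) = a *: omul x y + omul x z.
Proof.
move: x y z => [[[[x0 x1] x2] x3] [[[x4 x5] x6] x7]].
move=> [[[[y0 y1] y2] y3] [[[y4 y5] y6] y7]].
move=> [[[[z0 z1] z2] z3] [[[z4 z5] z6] z7]].
rewrite !oct_simp /omul /hconj /hmul !oct_simp.
by apply: oE; apply: hE; rewrite /= /GRing.scale /=; ring.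
Qed.

Definition ocdot (R : realType) (x y : octonion R) : R := ore (omul x (oconj y)).

Lemma ocdotE (R : realType) (x0 x1 x2 x3 x4 x5 x6 x7 : R)
    (y0 y1 y2 y3 y4 y5 y6 y7 : R) :
  ocdot ((x0, x1, x2, x3), (x4, x5, x6, x7))
        ((y0, y1, y2, y3), (y4, y5, y6, y7)) =
  x0 * y0 + x1 * y1 + x2 * y2 + x3 * y3
  + x4 * y4 + x5 * y5 + x6 * y6 + x7 * y7.
Proof.
rewrite /ocdot /omul /oconj /= /hmul /hconj /= !oct_simp /ore /hre /=; ring.
Qed.

Lemma ocdotC (R : realType) (x y : octonion R) : ocdot x y = ocdot y x.
Proof.
move: x y => [[[[x0 x1] x2] x3] [[[x4 x5] x6] x7]].
by move=> [[[[y0 y1] y2] y3] [[[y4 y5] y6] y7]]; rewrite !ocdotE; ring.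
Qed.

Lemma ocdot_linearl (R : realType) (a : R) (x y z : octonion R) :
  ocdot (a *: x + y) z = a * ocdot x z + ocdot y z.
Proof.
move: x y z => [[[[x0 x1] x2] x3] [[[x4 x5] x6] x7]].
move=> [[[[y0 y1] y2] y3] [[[y4 y5] y6] y7]].
move=> [[[[z0 z1] z2] z3] [[[z4 z5] z6] z7]].
by rewrite !oct_simp !ocdotE /GRing.scale /=; ring.
Qed.

Lemma ocdot_ge0 (R : realType) (x : octonion R) : 0 <= ocdot x x.
Proof.
move: x => [[[[x0 x1] x2] x3] [[[x4 x5] x6] x7]].
by rewrite ocdotE !addr_ge0 // -expr2 sqr_ge0.
Qed.

Lemma ocdot_eq0 (R : realType) (x : octonion R) : ocdot x x = 0 -> x = 0.
Proof.
move: x => [[[[x0 x1] x2] x3] [[[x4 x5] x6] x7]].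
rewrite ocdotE -!expr2 => /eqP.
do 7!rewrite paddr_eq0 ?addr_ge0 ?sqr_ge0 //.
rewrite !sqrf_eq0 -!andbA; do 7!case/andP=> /eqP->.
by move=> /eqP->.
Qed.

Lemma ore_sum (R : realType) (k : nat) (F : 'I_k -> octonion R) :
  ore (\sum_(i < k) F i) = \sum_(i < k) ore (F i).
Proof. by apply: (big_morph (@ore R)). Qed.

Lemma oct_dotE (R : realType) (k : nat) (z w : octvec R k) :
  oct_dot z w = \sum_(i < k) ocdot (z i) (w i).
Proof. by rewrite /oct_dot /oct_herm ore_sum. Qed.

Lemma oct_dotC (R : realType) (k : nat) (z w : octvec R k) :
  oct_dot z w = oct_dot w z.
Proof. by rewrite !oct_dotE; apply: eq_bigr => i _; apply: ocdotC. Qed.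

Lemma oct_dot_linearl (R : realType) (k : nat) (a : R) (x y z : octvec R k) :
  oct_dot (a *: x + y) z = a * oct_dot x z + oct_dot y z.
Proof.
rewrite !oct_dotE mulr_sumr -big_split /=; apply: eq_bigr => i _.
by rewrite -ocdot_linearl !ffunE.
Qed.

Lemma oct_dot_linearr (R : realType) (k : nat) (a : R) (x y z : octvec R k) :
  oct_dot z (a *: x + y) = a * oct_dot z x + oct_dot z y.
Proof. by rewrite 3!(oct_dotC z) oct_dot_linearl. Qed.

Lemma oct_dot_gt0 (R : realType) (k : nat) (x : octvec R k) :
  x != 0 -> 0 < oct_dot x x.
Proof.
move=> xN0; rewrite lt_neqAle eq_sym oct_dotE.
rewrite sumr_ge0 ?andbT => [|i _]; last exact: ocdot_ge0.
apply: contra xN0 => /eqP/psumr_eq0P x0; apply/eqP/ffunP => i.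
rewrite ffunE; apply/ocdot_eq0/x0 => // j _; exact: ocdot_ge0.
Qed.

Lemma oct_dot_bilinear (R : realType) (k : nat) :
  bilinear_for (GRing.Scale.Law.clone _ _ *%R _)
    (GRing.Scale.Law.clone _ _ *%R _) (@oct_dot R k).
Proof.
by split=> u a x y /=; [exact: oct_dot_linearl | exact: oct_dot_linearr].
Qed.

HB.instance Definition _ (R : realType) (k : nat) :=
  bilinear_isBilinear.Build R (octvec R k) (octvec R k) R _ _ (@oct_dot R k)
    (@oct_dot_bilinear R k).

Lemma oct_dot_herm (R : realType) (k : nat) (x y : octvec R k) :
  oct_dot x y = (-1) ^+ false * idfun (oct_dot y x).
Proof. by rewrite expr0 mul1r oct_dotC. Qed.

HB.instance Definition _ (R : realType) (k : nat) :=
  isHermitianSesquilinear.Build R (octvec R k) false idfun (@oct_dot R k)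
    (@oct_dot_herm R k).

HB.instance Definition _ (R : realType) (k : nat) :=
  isDotProduct.Build R (octvec R k) (@oct_dot R k) (@oct_dot_gt0 R k).

Lemma octpair_dotC (R : realType) (k : nat) (x y : octpair R k) :
  octpair_dot x y = octpair_dot y x.
Proof. by rewrite /octpair_dot oct_dotC [in X in _ + X]oct_dotC. Qed.

Lemma octpair_dot_linearl (R : realType) (k : nat) (a : R)
    (x y z : octpair R k) :
  octpair_dot (a *: x + y) z = a * octpair_dot x z + octpair_dot y z.
Proof. by rewrite /octpair_dot /= !oct_dot_linearl mulrDr addrACA. Qed.

Lemma octpair_dot_gt0 (R : realType) (k : nat) (x : octpair R k) :
  x != 0 -> 0 < octpair_dot x x.
Proof.
have ge0 (u : octvec R k) : 0 <= oct_dot u u.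
  have [->|/oct_dot_gt0/ltW//] := eqVneq u 0.
  by rewrite oct_dotE sumr_ge0 // => i _; apply: ocdot_ge0.
case: x => u v; rewrite /octpair_dot /=.
have [->|uN0 _] := eqVneq u 0; last by rewrite ltr_wpDr // oct_dot_gt0.
have [->|vN0 _] := eqVneq v 0; first by rewrite eqxx.
by rewrite ltr_wpDl // oct_dot_gt0.
Qed.

Lemma octpair_dot_bilinear (R : realType) (k : nat) :
  bilinear_for (GRing.Scale.Law.clone _ _ *%R _)
    (GRing.Scale.Law.clone _ _ *%R _) (@octpair_dot R k).
Proof.
split=> u a x y /=; first exact: octpair_dot_linearl.
by rewrite 3!(octpair_dotC u) octpair_dot_linearl.
Qed.

HB.instance Definition _ (R : realType) (k : nat) :=
  bilinear_isBilinear.Build R (octpair R k) (octpair R k) R _ _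
    (@octpair_dot R k) (@octpair_dot_bilinear R k).

Lemma octpair_dot_herm (R : realType) (k : nat) (x y : octpair R k) :
  octpair_dot x y = (-1) ^+ false * idfun (octpair_dot y x).
Proof. by rewrite expr0 mul1r octpair_dotC. Qed.

HB.instance Definition _ (R : realType) (k : nat) :=
  isHermitianSesquilinear.Build R (octpair R k) false idfun (@octpair_dot R k)
    (@octpair_dot_herm R k).

HB.instance Definition _ (R : realType) (k : nat) :=
  isDotProduct.Build R (octpair R k) (@octpair_dot R k) (@octpair_dot_gt0 R k).

Lemma oct_E_linear (R : realType) (k a : nat) (c : R) (u v : octvec R k) :
  oct_E a (c *: u + v) = c *: oct_E a u + oct_E a v.
Proof. by apply/ffunP => i; rewrite !ffunE omul_linearr. Qed.

Lemma oct_P0_linear (R : realType) (k : nat) : linear (@oct_P0 R k).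
Proof.
move=> c [u1 u2] [v1 v2]; congr (_, _).
by transitivity (c *: (- u2) + - v2); rewrite // scalerN -opprD.
Qed.

HB.instance Definition _ (R : realType) (k : nat) :=
  GRing.isLinear.Build R (octpair R k) (octpair R k) _ (@oct_P0 R k)
    (@oct_P0_linear R k).

Lemma oct_P1_linear (R : realType) (k : nat) : linear (@oct_P1 R k).
Proof. by move=> c [u1 u2] [v1 v2]. Qed.

HB.instance Definition _ (R : realType) (k : nat) :=
  GRing.isLinear.Build R (octpair R k) (octpair R k) _ (@oct_P1 R k)
    (@oct_P1_linear R k).

Lemma oct_PE_linear (R : realType) (k a : nat) : linear (@oct_PE R k a).
Proof.
move=> c [u1 u2] [v1 v2]; rewrite /oct_PE /= !oct_E_linear; congr (_, _).
by transitivity (c *: (- oct_E a u1) + - oct_E a v1); rewrite // scalerN -opprD.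
Qed.

HB.instance Definition _ (R : realType) (k a : nat) :=
  GRing.isLinear.Build R (octpair R k) (octpair R k) _ (@oct_PE R k a)
    (@oct_PE_linear R k a).


Lemma omulDl (R : realType) (x y z : octonion R) :
  omul (x + y) z = omul x z + omul y z.
Proof.
move: x y z => [[[[x0 x1] x2] x3] [[[x4 x5] x6] x7]].
move=> [[[[y0 y1] y2] y3] [[[y4 y5] y6] y7]].
move=> [[[[z0 z1] z2] z3] [[[z4 z5] z6] z7]].
by rewrite /omul /hconj /hmul; apply: oE; apply: hE; rewrite /=; ring.
Qed.

Lemma omul_sq (R : realType) (x y : octonion R) :
  ore x = 0 -> omul x (omul x y) = - ocdot x x *: y.
Proof.
move: x y => [[[[x0 x1] x2] x3] [[[x4 x5] x6] x7]].
move=> [[[[y0 y1] y2] y3] [[[y4 y5] y6] y7]].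
rewrite /ore /hre ocdotE /= => ->.
rewrite /omul /hconj /hmul; apply: oE; apply: hE; rewrite /= /GRing.scale /=.
all: ring.
Qed.

Lemma omul_skew (R : realType) (x y z : octonion R) :
  ore x = 0 -> ocdot (omul x y) z = - ocdot y (omul x z).
Proof.
move: x y z => [[[[x0 x1] x2] x3] [[[x4 x5] x6] x7]].
move=> [[[[y0 y1] y2] y3] [[[y4 y5] y6] y7]].
move=> [[[[z0 z1] z2] z3] [[[z4 z5] z6] z7]].
rewrite {1}/ore /hre /= => ->.
rewrite /ocdot /omul /oconj /hconj /hmul /ore /hre /=; ring.
Qed.

Lemma ocdot_linearr (R : realType) (a : R) (x y z : octonion R) :
  ocdot z (a *: x + y) = a * ocdot z x + ocdot z y.
Proof. by rewrite 3!(ocdotC z) ocdot_linearl. Qed.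

Lemma ocdotDD (R : realType) (x y : octonion R) :
  ocdot (x + y) (x + y) = ocdot x x + ocdot y y + 2 * ocdot x y.
Proof.
rewrite -[X in ocdot (X + _)]scale1r -[X in ocdot _ (X + _)]scale1r.
by rewrite ocdot_linearl !ocdot_linearr (ocdotC y x); ring.
Qed.

Lemma omulDr (R : realType) (x y z : octonion R) :
  omul x (y + z) = omul x y + omul x z.
Proof. by rewrite -[y in LHS]scale1r omul_linearr scale1r. Qed.

Lemma omulN (R : realType) (x y : octonion R) : omul x (- y) = - omul x y.
Proof.
have o0 : omul x 0 = 0.
  by apply: (@addrI _ (omul x 0)); rewrite -omulDr !addr0.
by apply: (@addrI _ (omul x y)); rewrite -omulDr !subrr.
Qed.

Lemma omul_anti (R : realType) (x y z : octonion R) :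
  ore x = 0 -> ore y = 0 ->
  omul x (omul y z) + omul y (omul x z) = - (2 * ocdot x y) *: z.
Proof.
move=> x0 y0; have xy0 : ore (x + y) = 0.
  by rewrite -[RHS]addr0 -{1}x0 -y0.
have := omul_sq z xy0.
rewrite !omulDl !omulDr ocdotDD (omul_sq z x0) (omul_sq z y0) => E.
apply: (addrI (- (ocdot x x + ocdot y y) *: z)).
rewrite -scalerDl -opprD -E opprD scalerDl -!addrA; congr (_ + _).
by rewrite addrC -!addrA.
Qed.

Lemma ore_e (R : realType) (a : nat) : (0 < a)%N -> ore (oct_e R a) = 0.
Proof. by case: a => [|[|[|[|[|[|[|[|[|a]]]]]]]]]. Qed.

Lemma ocdot_e (R : realType) (a b : nat) : (a < 8)%N -> (b < 8)%N ->
  ocdot (oct_e R a) (oct_e R b) = (a == b)%:R.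
Proof.
case: a => [|[|[|[|[|[|[|[|//]]]]]]]] _;
case: b => [|[|[|[|[|[|[|[|//]]]]]]]] _;
by rewrite ocdotE ?(mul0r, mulr0, mulr1, addr0, add0r).
Qed.

Definition oct_shift (R : realType) (a : nat) (x : octonion R) : octonion R :=
  let: ((x0, x1, x2, x3), (x4, x5, x6, x7)) := x in
  match a with
  | 1 => ((- x1, x0, - x3, x2), (- x5, x4, x7, - x6))
  | 2 => ((- x2, x3, x0, - x1), (- x6, - x7, x4, x5))
  | 3 => ((- x3, - x2, x1, x0), (- x7, x6, - x5, x4))
  | 4 => ((- x4, x5, x6, x7), (x0, - x1, - x2, - x3))
  | 5 => ((- x5, - x4, x7, - x6), (x1, x0, x3, - x2))
  | 6 => ((- x6, - x7, - x4, x5), (x2, - x3, x0, x1))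
  | 7 => ((- x7, x6, - x5, - x4), (x3, x2, - x1, x0))
  | _ => x
  end.

Lemma omul_eE (R : realType) (a : nat) (x : octonion R) :
  (0 < a < 8)%N -> omul (oct_e R a) x = oct_shift a x.
Proof.
move: x => [[[[x0 x1] x2] x3] [[[x4 x5] x6] x7]].
case: a => [|[|[|[|[|[|[|[|//]]]]]]]] // _; rewrite /omul /hmul /hconj;
  apply: oE; apply: hE; rewrite /=; ring.
Qed.

Lemma oct_e_prod (R : realType) (x : octonion R) :
  omul (oct_e R 1) (omul (oct_e R 2) (omul (oct_e R 3) (omul (oct_e R 4)
    (omul (oct_e R 5) (omul (oct_e R 6) (omul (oct_e R 7) x)))))) = - x.
Proof.
rewrite !omul_eE //; move: x => [[[[x0 x1] x2] x3] [[[x4 x5] x6] x7]].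
by rewrite /oct_shift; apply: oE; apply: hE; rewrite ?opprK.
Qed.

Lemma octpair_dim (R : realType) (k : nat) :
  \dim {: octpair R k} = (2 * (8 * k))%N.
Proof.
rewrite dimvf.
have -> : dim (octpair R k) = (#|'I_k| * 8 + #|'I_k| * 8)%N by [].
by rewrite card_ord; lia.
Qed.

Lemma oct_PE_sym (R : realType) (k a : nat) (x y : octpair R k) :
  (0 < a < 8)%N -> octpair_dot (oct_PE a x) y = octpair_dot x (oct_PE a y).
Proof.
move=> /andP[a0 a8]; rewrite /octpair_dot /= ![oct_dot _ (- _)]linearNr.
rewrite ![oct_dot (- _) _]linearNl /= !oct_dotE addrC.
congr (_ + _); rewrite -sumrN; apply: eq_bigr => i _;
  by rewrite !ffunE omul_skew ?opprK ?ore_e.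
Qed.

Lemma oct_P_sym (R : realType) (k : nat) (i : 'I_9) (x y : octpair R k) :
  octpair_dot (oct_P R k i x) y = octpair_dot x (oct_P R k i y).
Proof.
case: i => [[|[|i]]] lti9; rewrite /oct_P /= !lfunE /=.
- by rewrite /octpair_dot /= linearNl linearNr.
- by rewrite /octpair_dot /= addrC.
- exact: oct_PE_sym.
Qed.

Lemma oct_EN (R : realType) (k a : nat) (u : octvec R k) :
  oct_E a (- u) = - oct_E a u.
Proof. by apply/ffunP => i; rewrite !ffunE omulN. Qed.

Lemma oct_E_anti (R : realType) (k a b : nat) (u : octvec R k) :
  (0 < a < 8)%N -> (0 < b < 8)%N ->
  oct_E a (oct_E b u) + oct_E b (oct_E a u) = - (2 * (a == b)%:R) *: u.
Proof.
move=> /andP[a0 a8] /andP[b0 b8]; apply/ffunP => i.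
by rewrite !ffunE omul_anti ?ore_e // ocdot_e.
Qed.

Lemma oct_P_rel (R : realType) (k : nat) (i j : 'I_9) :
  (oct_P R k i \o oct_P R k j)%VF + (oct_P R k j \o oct_P R k i)%VF
    = (2 * (i == j)%:R) *: \1%VF.
Proof.
apply/lfunP => -[u v].
rewrite add_lfunE scale_lfunE id_lfunE !comp_lfunE -val_eqE /=.
have pE (u1 u2 v1 v2 : octvec R k) :
  ((u1, u2) : octpair R k) + (v1, v2) = (u1 + v1, u2 + v2) by [].
have sE c (u1 u2 : octvec R k) :
  c *: ((u1, u2) : octpair R k) = (c *: u1, c *: u2) by [].
case: i j => [[|[|i]] lti9] [[|[|j]] ltj9];
  rewrite /oct_P /= !lfunE /= ?lfunE /= /oct_P0 /oct_P1 /oct_PE /= ?oct_EN pE sE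
    ?opprK ?mulr0 ?mulr1 ?scale0r ?scaler_nat ?addNr ?subrr ?mulr2n //.
rewrite -!opprD !oct_E_anti // !eqSS.
by rewrite !scaleNr !opprK.
Qed.

Lemma octpair_dim_mult (R : realType) (k : nat) : (2 <= k)%N ->
  \dim {: octpair R k} = (2 * (8 + (8 * k - 9)).+1)%N.
Proof. by move=> k2; rewrite octpair_dim; lia. Qed.

Lemma oct_m2_gt0 (k : nat) : (2 <= k)%N -> (0 < 8 * k - 9)%N.
Proof. by lia. Qed.

Definition oct_otfkm (R : realType) (k : nat) (k2 : (2 <= k)%N) :
    otfkm (@octpair_dot R k) 8 (8 * k - 9) :=
  OTFKM
    (CliffordSystem (octpair_dim_mult R k2) (@oct_P_sym R k) (@oct_P_rel R k))
    (oct_m2_gt0 k2).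

Lemma oct_E_prod (R : realType) (k : nat) (u : octvec R k) :
  oct_E 1 (oct_E 2 (oct_E 3 (oct_E 4 (oct_E 5 (oct_E 6 (oct_E 7 u)))))) = - u.
Proof. by apply/ffunP => i; rewrite !ffunE oct_e_prod. Qed.

Lemma oct_PEE (R : realType) (k a b : nat) (x : octpair R k) :
  oct_PE a (oct_PE b x) = (- oct_E a (oct_E b x.1), - oct_E a (oct_E b x.2)).
Proof. by rewrite /oct_PE /= oct_EN. Qed.

Lemma oct_otfkm_prod (R : realType) (k : nat) (k2 : (2 <= k)%N) :
  clifford_prod (oct_otfkm R k2) = - \1%VF.
Proof.
apply/lfunP => -[u v]; rewrite /clifford_prod !big_ord_recl big_ord0.
rewrite !comp_lfunE opp_lfunE !id_lfunE /= /oct_P /= !lfunE /=.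
rewrite (oct_PEE 6 7) (oct_PEE 4 5) /= (oct_PEE 2 3) /=.
rewrite /oct_PE /oct_P1 /oct_P0 /=.
by congr (_, _); rewrite !oct_EN !opprK oct_E_prod ?opprK.
Qed.

Lemma oct_otfkm_definite (R : realType) (k : nat) (k2 : (2 <= k)%N) :
  clifford_definite (oct_otfkm R k2).
Proof. by right; apply: oct_otfkm_prod. Qed.

(* Main.v *)
(** For octonions <e y, z> = <e, z ybar>.  Hence <P_{1+a}(z,w), (z,w)> is twice
    the e_a-coordinate of <z,w>_O for every a >= 0 (with e_0 = 1), so these
    quadratic forms all vanish exactly when <z,w>_O = 0.  The remaining
    conditions, |z|^2 - |w|^2 = 0 and |z|^2 + |w|^2 = 1, fix both norms. *)

Require Import Defs.
From mathcomp Require Import all_boot all_order all_algebra.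
From mathcomp Require Import ring lra.
From mathcomp Require Import classical_sets reals.

Import Order.TTheory GRing.Theory Num.Theory.
Local Open Scope ring_scope.

(** The octonion product is not associative, but its real part is: Re((x y) zbar) = Re(x (y zbar)),
    and y zbar is the conjugate of z ybar. *)
Lemma ocdot_omull (R : realType) (x y z : octonion R) :
  ocdot (omul x y) z = ocdot x (omul z (oconj y)).
Proof.
move: x y z => [[[[x0 x1] x2] x3] [[[x4 x5] x6] x7]].
move=> [[[[y0 y1] y2] y3] [[[y4 y5] y6] y7]].
move=> [[[[z0 z1] z2] z3] [[[z4 z5] z6] z7]].
by rewrite /ocdot /omul /oconj /hconj /hmul /ore /hre /=; ring.
Qed.

Lemma ocdot0r (R : realType) (x : octonion R) : ocdot x 0 = 0.
Proof.
by apply: (addrI (ocdot x 0)); rewrite -{1}[ocdot x 0]mul1r -ocdot_linearr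
  scaler0 !addr0.
Qed.

Lemma ocdot_sumr (R : realType) (k : nat) (x : octonion R)
    (F : 'I_k -> octonion R) :
  ocdot x (\sum_(i < k) F i) = \sum_(i < k) ocdot x (F i).
Proof.
apply: (big_morph (ocdot x)) => [y z|]; last exact: ocdot0r.
by rewrite -[y]scale1r ocdot_linearr mul1r scale1r.
Qed.

Lemma oct_dot_E (R : realType) (k a : nat) (z w : octvec R k) :
  oct_dot (oct_E a w) z = ocdot (oct_e R a) (oct_herm z w).
Proof.
rewrite oct_dotE /oct_herm ocdot_sumr; apply: eq_bigr => i _.
by rewrite ffunE ocdot_omull.
Qed.

Lemma ocdot_e0 (R : realType) (x : octonion R) : ocdot (oct_e R 0) x = ore x.
Proof.
move: x => [[[[x0 x1] x2] x3] [[[x4 x5] x6] x7]].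
by rewrite /oct_e /= ocdotE /ore /hre /=; ring.
Qed.

Lemma ocdot_e_eq0 (R : realType) (x : octonion R) :
  (forall a, (a < 8)%N -> ocdot (oct_e R a) x = 0) -> x = 0.
Proof.
move: x => [[[[x0 x1] x2] x3] [[[x4 x5] x6] x7]] x_e.
have := (x_e 0 isT, x_e 1 isT, x_e 2 isT, x_e 3 isT,
         x_e 4 isT, x_e 5 isT, x_e 6 isT, x_e 7 isT).
rewrite /oct_e /= !ocdotE => -[[[[[[[]]]]]]].
rewrite !(mul0r, mul1r, add0r, addr0).
by move=> -> -> -> -> -> -> -> ->.
Qed.

Lemma oct_P0_dot (R : realType) (k : nat) (z w : octvec R k) :
  octpair_dot (oct_P0 (z, w)) (z, w) = oct_dot z z - oct_dot w w.
Proof. by rewrite /octpair_dot /= linearNl. Qed.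

(** The real part is written as the coordinate along e_0 = 1 so that it has the same form as the
    seven imaginary coordinates in [oct_PE_dot]. *)
Lemma oct_P1_dot (R : realType) (k : nat) (z w : octvec R k) :
  octpair_dot (oct_P1 (z, w)) (z, w) = 2 * ocdot (oct_e R 0) (oct_herm z w).
Proof.
by rewrite /octpair_dot /= (oct_dotC w) ocdot_e0 mulr_natl mulr2n.
Qed.

Lemma oct_PE_dot (R : realType) (k a : nat) (z w : octvec R k) :
  (0 < a)%N ->
  octpair_dot (oct_PE a (z, w)) (z, w) = 2 * ocdot (oct_e R a) (oct_herm z w).
Proof.
move=> a0; rewrite /octpair_dot /= linearNl /= -oct_dot_E.
(* Left multiplication by the imaginary unit e_a is skew, so the two terms of the difference add up
   instead of cancelling. *)
have -> : oct_dot (oct_E a z) w = - oct_dot (oct_E a w) z.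
  rewrite !oct_dotE -sumrN; apply: eq_bigr => i _.
  by rewrite !ffunE omul_skew ?ore_e // ocdotC.
by rewrite opprK mulr_natl mulr2n.
Qed.

Lemma oct_P_dot_eq0 (R : realType) (k : nat) (z w : octvec R k) :
  (forall i, octpair_dot (oct_P R k i (z, w)) (z, w) = 0) <->
  oct_dot z z = oct_dot w w /\ oct_herm z w = 0.
Proof.
split=> [P0 | [zw h0] [[|[|i]] lti9]].
- split.
    by have := P0 ord0; rewrite /oct_P /= lfunE /= oct_P0_dot => /subr0_eq.
  (* The e_a-coordinate is read off from P_{a+1}: P_1 for a = 0, and the operators built from E_a
     for a = 1, ..., 7. *)
  apply: ocdot_e_eq0 => a a8; have := P0 (@Ordinal 9 a.+1 a8).
  case: a a8 => [|a] a8; rewrite /oct_P /= lfunE /=.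
    by rewrite oct_P1_dot => /eqP; rewrite mulf_eq0 pnatr_eq0 => /eqP.
  by rewrite oct_PE_dot // => /eqP; rewrite mulf_eq0 pnatr_eq0 => /eqP.
- by rewrite /oct_P /= lfunE /= oct_P0_dot zw subrr.
- by rewrite /oct_P /= lfunE /= oct_P1_dot h0 ocdot0r mulr0.
- by rewrite /oct_P /= lfunE /= oct_PE_dot // h0 ocdot0r mulr0.
Qed.

Lemma enorm_eq (R : realType) (V : vectType R) (dot : {dot V for idfun})
    (x : V) (r : R) :
  0 <= r -> (enorm dot x = r) <-> (dot x x = r ^+ 2).
Proof.
move=> r0; rewrite /enorm; split=> [<-|->]; last by rewrite sqrtr_sqr ger0_norm.
(* Squaring the root needs [dot x x] to be nonnegative; definiteness gives this for nonzero x, and x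
   = 0 is computed directly. *)
have [->|/(@neq0_dnorm_gt0 _ _ _ dot)/ltW x0] := eqVneq x 0.
  by rewrite linear0r sqrtr0 expr0n.
by rewrite sqr_sqrtr.
Qed.

Theorem proposition5 (R : realType) (k : nat) (k2 : (2 <= k)%N)
    (z w : octvec R k) :
  focal_plus (oct_otfkm R k2) (z, w) <->
  [/\ enorm (@oct_dot R k) z = 1 / Num.sqrt 2,
      enorm (@oct_dot R k) w = 1 / Num.sqrt 2
    & oct_herm z w = 0].
Proof.
have s0 : 0 <= 1 / Num.sqrt 2 :> R by rewrite divr_ge0 ?sqrtr_ge0.
have s2 : (1 / Num.sqrt 2) ^+ 2 = 2^-1 :> R.
  by rewrite div1r exprVn sqr_sqrtr.
split.
  case=> /(enorm_eq _ _ _ _ _ ler01); rewrite expr1n /= /octpair_dot /= => zw1.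
  (* Equal squared norms with sum 1 are both 1/2. *)
  by case/oct_P_dot_eq0=> zw h0; split=> //; apply/enorm_eq => //; rewrite s2; lra.
case=> /(enorm_eq _ _ _ _ _ s0) z2 /(enorm_eq _ _ _ _ _ s0) w2 h0.
move: z2 w2; rewrite s2 /= => z2 w2; split.
  by apply/enorm_eq => //; rewrite expr1n /= /octpair_dot /= z2 w2; lra.
by apply/oct_P_dot_eq0; rewrite z2 w2.
Qed.
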